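(* Let $D$ be a distortion function and let $Q$ be the probability measure on $\mathcal{B}((0,1))$ corresponding to $D$. Assume that there exist some $n\in\mathbb{N}$ and $\alpha,\delta\in(0,1)$ such that $$D^{\mathrm{ES}_{n,\alpha}}(u)\le D(u)\le D^E(u)$$ holds for every $u\in[\delta,1)$. Then $\mathcal{L}_Q=\mathcal{L}_{Q^E}$.
   Context: ''Increasing'' is meant in the weak sense; $\mathbb{N}=\{1,2,\dots\}$. $(\Omega,\mathcal{F},P)$ is a fixed probability space and $\mathcal{L}^0$ is the set of all real random variables on it. For $X\in\mathcal{L}^0$, $F_X(x):=P[\{X\le x\}]$ and $F_X^\leftarrow:(0,1)\to\mathbb{R}$, $F_X^\leftarrow(u):=\inf\{x\in\mathbb{R}\mid F_X(x)\ge u\}$, is the (lower) quantile function. A distortion function is an increasing, right-continuous function $D:[0,1]\to[0,1]$ with $D(0)=0$ and $\sup_{u\in(0,1)}D(u)=1$ (hence $D(1)=1$). The probability measure $Q$ on $\mathcal{B}((0,1))$ corresponding to $D$ is the unique one with $Q[(0,u]]=D(u)$ for all $u\in(0,1)$. For such $Q$, $\mathcal{L}_Q:=\{X\in\mathcal{L}^0\mid\int_{(0,1)}(F_X^\leftarrow(u))^+\,dQ(u)<\infty\}$. Particular distortion functions: $D^E(u):=u$, with corresponding probability measure $Q^E$ (Lebesgue measure on $(0,1)$); and, for $n\in\mathbb{N}$ and $\alpha\in[0,1)$, $D^{\mathrm{ES}_{n,\alpha}}(u):=\bigl(\frac{u-\alpha}{1-\alpha}\bigr)^n\chi_{[\alpha,1]}(u)$,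 where $\chi_B$ is the indicator function of $B$. *)

(* Defs.v *)
From HB Require Import structures.
From mathcomp Require Import all_boot all_order all_algebra.
From mathcomp Require Import all_classical all_reals all_analysis.

Set Implicit Arguments.
Unset Strict Implicit.
Unset Printing Implicit Defensive.

Import Order.TTheory GRing.Theory Num.Theory.
Import numFieldNormedType.Exports.

Local Open Scope classical_set_scope.
Local Open Scope ring_scope.

(* A function [0,1] -> [0,1] is represented by a function R -> R of which only
   the values on [0,1] are constrained.  Right-continuity at 1 is vacuous. *)
Record distortion_function (R : realType) (D : R -> R) : Prop := {
  distortion_range : forall u : R, u \in `[0, 1] -> 0 <= D u <= 1 ;
  distortion_nondecreasing : {in `[0, 1] &, nondecreasing_fun D} ;
  distortion_right_continuous : forall u : R, u \in `[0, 1[ -> D x @[x --> u^'+] --> D u ;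
  distortion0 : D 0 = 0 ;
  distortion_sup : sup (D @` `]0, 1[) = 1
}.

(* A probability measure on the Borel sets of (0,1) is represented by the
   Borel probability measure on R that extends it by 0 outside (0,1). *)
Record corresponding_measure (R : realType) (D : R -> R)
    (Q : probability (measurableTypeR R) R) : Prop := {
  corresponding_support : Q `]0, 1[%classic = 1%E ;
  corresponding_cdf : forall u : R, u \in `]0, 1[ -> Q `]0, u]%classic = (D u)%:E
}.

Definition distortion_E (R : realType) (u : R) : R := u.

Definition distortion_ES (R : realType) (n : nat) (alpha u : R) : R :=
  ((u - alpha) / (1 - alpha)) ^+ n * \1_(`[alpha, 1]%classic) u.

Definition lower_quantile d (Omega : measurableType d) (R : realType)
    (P : probability Omega R) (X : {RV P >-> R}) (u : R) : R :=
  inf [set x : R | (u%:E <= cdf X x)%E].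

Definition L_of d (Omega : measurableType d) (R : realType)
    (P : probability Omega R) (Q : probability (measurableTypeR R) R) :
    set {RV P >-> R} :=
  [set X | (\int[Q]_(u in `]0%R, 1%R[) (Num.max (lower_quantile X u) 0)%:E
            < +oo)%E].
Arguments L_of {d Omega R} P Q.

Section Q_E.
Variable R : realType.

Definition Q_E : set (measurableTypeR R) -> \bar R :=
  mrestr (@lebesgue_measure R) (measurable_itv `]0, 1[).

HB.instance Definition _ := Measure.on Q_E.

Let Q_E_setT : Q_E setT = 1%E.
Proof.
rewrite /Q_E /mrestr setTI lebesgue_measure_itv/= lte_fin ltr01.
by rewrite -EFinB subr0.
Qed.

HB.instance Definition _ := Measure_isProbability.Build _ _ _ Q_E Q_E_setT.

Fact distortion_E_distortion : distortion_function (@distortion_E R).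
Proof.
split.
- by move=> u; rewrite in_itv.
- by move=> u v _ _.
- by move=> u _; apply: cvg_at_right_filter.
- by [].
- by rewrite /distortion_E image_id; apply: sup_itv; rewrite bnd_simp.
Qed.

Fact Q_E_corresponding : corresponding_measure (@distortion_E R) Q_E.
Proof.
split.
  rewrite /= /Q_E /mrestr setIid lebesgue_measure_itv/= lte_fin ltr01.
  by rewrite -EFinB subr0.
move=> u; rewrite in_itv/= => /andP[u0 u1].
rewrite /= /Q_E /mrestr setIidl; last first.
  by move=> x /=; rewrite !in_itv/= => /andP[-> xu]; exact: le_lt_trans u1.
by rewrite lebesgue_measure_itv/= lte_fin u0 -EFinB subr0.
Qed.

End Q_E.

Arguments Q_E : clear implicits.

(* Main.v *)
From HB Require Import structures.
Require Import Defs.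
From mathcomp Require Import all_boot all_order all_algebra.
From mathcomp Require Import all_classical all_reals all_analysis.
From mathcomp Require Import measurable_realfun ring lra.

(* Since [F_X^<-(u) <= t <-> u <= F_X(t)], the layer-cake formula turns the
   integral defining [L_Q] into [\int_0^oo Q(]F_X(t), 1[) dt].  As [F_X(t)]
   eventually exceeds any [delta < 1], only the tails [Q(]u, 1[) = 1 - D(u)] for
   [u] near 1 matter.  The hypothesis makes them comparable with the Lebesgue
   tails [1 - u]: [D(u) <= u] gives one bound, and Bernoulli's inequality
   [1 - x^n <= n (1 - x)] at [x = (u - alpha) / (1 - alpha)] gives the other, with
   constant [n / (1 - alpha)]. *)

Import Order.TTheory GRing.Theory Num.Theory.
Import numFieldNormedType.Exports.

Local Open Scope classical_set_scope.
Local Open Scope ring_scope.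

(** Induction via [1 - x^(n+1) = (1 - x) + x (1 - x^n)], where the factor [x <= 1] is dropped. *)
Lemma bernoulli_subX (R : realDomainType) (x : R) (n : nat) :
  0 <= x <= 1 -> 1 - x ^+ n <= n%:R * (1 - x).
Proof.
move=> /andP[x0 x1]; elim: n => [|n IH]; first by rewrite expr0 mul0r subrr.
have -> : 1 - x ^+ n.+1 = (1 - x) + x * (1 - x ^+ n).
  by rewrite exprS mulrBr mulr1 addrA subrK.
rewrite -nat1r mulrDl mul1r lerD2l (le_trans _ IH)// ler_piMl// subr_ge0.
exact: exprn_ile1.
Qed.

Lemma fin_num_cdf d (Omega : measurableType d) (R : realType)
  (P : probability Omega R) (X : {RV P >-> R}) (t : R) :
  cdf X t \is a fin_num.
Proof. by rewrite fin_num_measure. Qed.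

(** Galois connection between quantile and cdf: right-continuity makes the infimum attained, and the
    limits of the cdf at [-oo] and [+oo] make [S] bounded below and nonempty. *)
Lemma lower_quantile_le d (Omega : measurableType d) (R : realType)
    (P : probability Omega R) (X : {RV P >-> R}) (u t : R) : 0 < u < 1 ->
  (lower_quantile X u <= t) = (u%:E <= cdf X t)%E.
Proof.
move=> /andP[u0 u1]; rewrite /lower_quantile; set S := [set x | _].
have lbS s : (cdf X s < u%:E)%E -> lbound S s.
  move=> su x /= ux; rewrite leNgt; apply/negP => xs.
  have := lt_le_trans su ux; rewrite ltNge => /negP; apply.
  by apply: cdf_nondecreasing; exact: ltW.
apply/idP/idP; last first.
  move=> ut; apply: ge_inf => //.
  have : \forall s \near -oo, (cdf X s < u%:E)%E.
    have u0' : (0 < u%:E)%E by rewrite lte_fin.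
    exact: (cvg_cdfNy0 X (open_ereal_lt' u0')).
  by move=> /filter_ex[s /lbS ?]; exists s.
apply: contraTT; rewrite -!ltNge => tu.
(* By right-continuity, [F(t) < u] persists slightly to the right of [t]; such an [s] is a lower
   bound of [S] strictly above [t]. *)
have [s [ts su]] : exists s, t < s /\ (cdf X s < u%:E)%E.
  have : \forall s \near t^'+, (cdf X s < u%:E)%E.
    exact: (@cdf_right_continuous _ _ _ _ X t _ (open_ereal_lt' tu)).
  move=> su; near t^'+ => s; exists s; split; near: s => //.
  exact: nbhs_right_gt.
rewrite (lt_le_trans ts)//; apply: lb_le_inf; last exact: lbS.
(* Nonemptiness of [S] matters here: [inf] of the empty set is 0 by default. *)
have : \forall s \near +oo, (u%:E < cdf X s)%E.
  have u1' : (u%:E < 1)%E by rewrite lte_fin.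
  exact: (cvg_cdfy1 X (open_ereal_gt' u1')).
by move=> /filter_ex[x ux]; exists x; exact: ltW.
Unshelve. all: by end_near. Qed.

Section positive_quantile.
Context d (Omega : measurableType d) (R : realType) (P : probability Omega R)
  (X : {RV P >-> R}).

(** Extension by 0 outside []0, 1[] gives a total function, hence a random variable under any
    [Q]. *)
Definition positive_quantile : measurableTypeR R -> R :=
  (fun u => Num.max (lower_quantile X u) 0) \_ `]0, 1[.

Lemma positive_quantile_ge0 u : 0 <= positive_quantile u.
Proof.
rewrite /positive_quantile patchE; case: ifP => // _.
by rewrite le_max lexx orbT.
Qed.

(** The Galois connection, negated. As [t >= 0], neither the truncation at 0 nor the extension by 0
    adds points. *)
Lemma preimage_positive_quantile (t : R) : 0 <= t ->
  positive_quantile @^-1` `]t, +oo[ = `]fine (cdf X t), 1[%classic.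
Proof.
move=> t0; apply/seteqP; split => u /=; rewrite !in_itv/= andbT.
  rewrite /positive_quantile patchE.
  case: ifPn => [|_]; last by rewrite ltNge t0.
  rewrite inE/= in_itv/= => u01; rewrite lt_max => /orP[|]; last first.
    by rewrite ltNge t0.
  rewrite ltNge lower_quantile_le// -ltNge -[cdf X t]fineK ?fin_num_cdf//.
  rewrite lte_fin => ->.
  by case/andP: u01.
move=> /andP[tu u1].
have u01 : 0 < u < 1 by rewrite u1 (le_lt_trans _ tu)// fine_ge0.
rewrite /positive_quantile patchE mem_set ?in_itv//= lt_max ltNge.
by rewrite lower_quantile_le// -ltNge -[cdf X t]fineK ?fin_num_cdf// lte_fin tu.
Qed.

Lemma measurable_positive_quantile : measurable_fun setT positive_quantile.
Proof.
apply: (measurability _ (RGenOInfty.measurableE R)) => //.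
move=> _ [_ [t ->] <-]; rewrite setTI.
have [t0|t0] := leP 0 t; first by rewrite preimage_positive_quantile.
rewrite (_ : _ @^-1` _ = setT) //; apply/seteqP; split => u //= _.
by rewrite in_itv/= andbT (lt_le_trans t0)// positive_quantile_ge0.
Qed.

HB.instance Definition _ := isMeasurableFun.Build _ _ _ _ positive_quantile
  measurable_positive_quantile.

(** Layer-cake formula: the expectation of a nonnegative variable is the integral of its ccdf. *)
Lemma integral_positive_part_lower_quantile
    (Q : probability (measurableTypeR R) R) :
  (\int[Q]_(u in `]0%R, 1%R[) (Num.max (lower_quantile X u) 0)%:E =
   \int[lebesgue_measure]_(t in `[0%R, +oo[) Q `]fine (cdf X t), 1%R[%classic)%E.
Proof.
pose Y : {RV Q >-> R} := positive_quantile.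
transitivity ('E_Q[Y])%E.
  rewrite expectation_def integral_mkcond; apply: eq_integral => u _.
  by rewrite /Y/= /positive_quantile !patchE; case: ifP.
rewrite ge0_expectation_ccdf; last exact: positive_quantile_ge0.
apply: eq_integral => t; rewrite inE/= in_itv/= andbT => t0.
by rewrite /ccdf /distribution /pushforward preimage_positive_quantile.
Qed.

Lemma measurable_quantile_tail (Q : probability (measurableTypeR R) R) :
  measurable_fun (`[0, +oo[%classic : set R) 
    (fun t => Q `]fine (cdf X t), 1[%classic).
Proof.
pose Y : {RV Q >-> R} := positive_quantile.
apply: (eq_measurable_fun (ccdf Y)).
  move=> t; rewrite inE/= in_itv/= andbT => t0.
  by rewrite /ccdf /distribution /pushforward preimage_positive_quantile.
by apply: measurable_funTS; exact: ccdf_measurable.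
Qed.

End positive_quantile.

(** Comparing tails near 1 suffices: where [F(t)] may still be below [delta], [t] ranges over a
    bounded interval, on which the tail is at most 1. *)
Lemma L_of_subset d (Omega : measurableType d) (R : realType)
    (P : probability Omega R) (Q1 Q2 : probability (measurableTypeR R) R)
    (c delta : R) : 0 <= c -> delta < 1 ->
  (forall u, delta <= u < 1 ->
    (Q1 `]u, 1%R[%classic <= c%:E * Q2 `]u, 1%R[%classic)%E) ->
  L_of P Q2 `<=` L_of P Q1.
Proof.
move=> c0 delta1 Q12 X.
rewrite /L_of/= !integral_positive_part_lower_quantile => X2.
have [t0 [t0_ge0 Ft0]] : exists t0, 0 <= t0 /\ (delta%:E < cdf X t0)%E.
  have Fd : \forall s \near +oo, (delta%:E < cdf X s)%E.
    have delta1' : (delta%:E < 1)%E by rewrite lte_fin.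
    exact: (cvg_cdfy1 X (open_ereal_gt' delta1')).
  near (pinfty_nbhs R) => t; exists t; split; near: t => //.
  exact: nbhs_pinfty_ge.
pose T (Q : probability (measurableTypeR R) R) (t : R) :=
  Q `]fine (cdf X t), 1[%classic.
have T12 t : 0 <= t ->
    (T Q1 t <= (\1_(`[0, t0]%classic) t)%:E + c%:E * T Q2 t)%E.
  move=> t_ge0; have [tt0|tt0] := leP t t0.
    rewrite indicE mem_set/= ?in_itv/= ?t_ge0//.
    rewrite (le_trans (probability_le1 _ _))// leeDl// mule_ge0//.
  rewrite indicE memNset/=; last by rewrite in_itv/= t_ge0/= leNgt tt0.
  rewrite add0e.
  (* If [F(t) = 1], the comparison of tails does not apply, but both tails are empty. *)
  have [F1|F1] := ltP (fine (cdf X t)) 1; last first.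
    by rewrite /T set_itv_ge ?bnd_simp -?leNgt// !measure0 mule0.
  rewrite /T; apply: Q12; rewrite F1 andbT -lee_fin fineK ?fin_num_cdf//.
  by rewrite (le_trans (ltW Ft0))//; apply: cdf_nondecreasing; exact: ltW.
pose f1 (t : R) : \bar R := (\1_(`[0, t0]%classic) t)%:E.
have mT2 : measurable_fun (`[0, +oo[%classic : set R)
    (fun t => c%:E * T Q2 t)%E.
  by apply: measurable_funeM; exact: measurable_quantile_tail.
have mf1 : measurable_fun (`[0, +oo[%classic : set R) f1.
  by apply/measurable_EFinP; exact: measurable_indic.
have T2_ge0 t : (0 <= c%:E * T Q2 t)%E by rewrite mule_ge0.
have f1_ge0 t : (0 <= f1 t)%E by rewrite lee_fin.
apply: (@le_lt_trans _ _ (\int[lebesgue_measure]_(t in `[0%R, +oo[)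
    (f1 t + c%:E * T Q2 t))%E).
  apply: ge0_le_integral => //; first exact: measurable_quantile_tail.
    exact: emeasurable_funD.
  by move=> t /=; rewrite in_itv/= andbT; exact: T12.
rewrite ge0_integralD// ge0_integralZl_EFin//; last first.
  exact: measurable_quantile_tail.
apply: lte_add_pinfty; last by rewrite lte_mul_pinfty.
rewrite integral_indic//=.
apply: (@le_lt_trans _ _ (@lebesgue_measure R `[0, t0]%classic)).
  by rewrite le_measure ?inE//; exact: measurableI.
by rewrite lebesgue_measure_itv/= lte_fin; case: ifP => // _; rewrite -EFinB ltry.
Unshelve. all: by end_near. Qed.

(** []0, 1[] has mass 1 and splits at [u]. *)
Lemma corresponding_tail (R : realType) (D : R -> R)
    (Q : probability (measurableTypeR R) R) (u : R) :
  corresponding_measure D Q -> 0 < u < 1 -> Q `]u, 1[%classic = (1 - D u)%:E.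
Proof.
move=> [Q1 QD] /andP[u0 u1].
have : (Q `]0%R, 1%R[%classic = Q `]0%R, u]%classic + Q `]u, 1%R[%classic)%E.
  rewrite -measureU//; last first.
    apply/seteqP; split => x //=; rewrite !in_itv/= => -[/andP[_ xu] /andP[ux _]].
    by have := le_lt_trans xu ux; rewrite ltxx.
  congr (Q _); apply/seteqP; split => x /=; rewrite !in_itv/=.
    by move=> /andP[-> ->]/=; rewrite andbT; case: leP => _; [left|right].
  by case=> /andP[x1 x2]; apply/andP; split => //;
    [exact: le_lt_trans u1|exact: lt_trans x1].
rewrite Q1 QD ?in_itv/= ?u0// => QE.
have Qfin : Q `]u, 1[%classic \is a fin_num by rewrite fin_num_measure.
by move: QE; rewrite -(fineK Qfin) -EFinD => -[?]; congr EFin; lra.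
Qed.

Theorem corollary3p7 (R : realType) (d : measure_display)
    (Omega : measurableType d) (P : probability Omega R)
    (D : R -> R) (Q : probability (measurableTypeR R) R)
    (hD : distortion_function D) (hQ : corresponding_measure D Q)
    (hbound : exists (n : nat) (alpha delta : R),
       [/\ (0 < n)%N, 0 < alpha < 1, 0 < delta < 1 &
           forall u : R, delta <= u < 1 ->
             distortion_ES n alpha u <= D u <= distortion_E u]) :
  L_of P Q = L_of P (Q_E R).
Proof.
have [n [alpha [delta [_ /andP[alpha0 alpha1] /andP[delta0 delta1] bound]]]] :=
  hbound.
have QE := corresponding_tail _ _ _ _ (Q_E_corresponding R).
apply/seteqP; split.
  (* [D(u) <= u] means that the Lebesgue tail is at most the [Q] tail, so the constant is 1. *)
  apply: (@L_of_subset _ _ _ _ _ _ 1 delta) => // u /andP[du u1].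
  have u01 : 0 < u < 1 by rewrite u1 (lt_le_trans delta0).
  rewrite mul1e QE// (corresponding_tail _ _ _ _ hQ)// lee_fin lerB//.
  by have := bound u; rewrite du u1 => /(_ isT)/andP[].
(* Beyond [alpha] the indicator in [distortion_ES] is 1 and its base lies in [[0, 1]], as
   Bernoulli's inequality requires. *)
pose m := Num.max alpha delta.
apply: (@L_of_subset _ _ _ _ _ _ (n%:R / (1 - alpha)) m).
- by rewrite divr_ge0// subr_ge0 ltW.
- by rewrite gt_max alpha1.
move=> u /andP[]; rewrite ge_max => /andP[au du] u1.
have u01 : 0 < u < 1 by rewrite u1 (lt_le_trans delta0).
rewrite QE// (corresponding_tail _ _ _ _ hQ)// -EFinM lee_fin.
have /andP[ESD _] : distortion_ES n alpha u <= D u <= distortion_E u.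
  by apply: bound; rewrite du.
have a1 : 0 < 1 - alpha by rewrite subr_gt0.
rewrite (le_trans (lerB (lexx 1) ESD))// /distortion_ES indicE mem_set/=;
  last first.
  by rewrite in_itv/= au ltW.
rewrite mulr1 (le_trans (bernoulli_subX _ _ _ _))//.
  rewrite divr_ge0 ?subr_ge0//= ?ler_pdivrMr// ?mul1r ?lerD2r ?(ltW u1)//.
  exact: ltW.
have -> : 1 - (u - alpha) / (1 - alpha) = (1 - u) / (1 - alpha).
  by field; exact: lt0r_neq0.
by rewrite mulrA mulrAC.
Qed.
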